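(* There exists a $1$-rotational $(624,8,1)$-RBIBD over the cyclic group $\mathbb{Z}_{623}$.
   Context: A $(v,k,\lambda)$-BIBD is a pair $(V,\mathcal{A})$ where $V$ is a set of $v$ points and $\mathcal{A}$ is a collection of $k$-subsets of $V$ (blocks) such that every $2$-subset of $V$ is contained in exactly $\lambda$ blocks of $\mathcal{A}$. It is resolvable (a $(v,k,\lambda)$-RBIBD) if there exists a partition $\mathcal{R}$ of $\mathcal{A}$ (a resolution) into parallel classes, each of which is a partition of $V$. An automorphism group of a $(v,k,\lambda)$-RBIBD $(V,\mathcal{A})$ with resolution $\mathcal{R}$ is a group of permutations of $V$ leaving both $\mathcal{A}$ and $\mathcal{R}$ invariant. A $(v,k,\lambda)$-RBIBD is $1$-rotational over a group $G$ of order $v-1$ if it admits $G$ as an automorphism group fixing one point and acting sharply transitively on the other points. *)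

(* Defs.v *)
From HB Require Import structures.
From mathcomp Require Import all_boot all_fingroup all_algebra.

Set Implicit Arguments.
Unset Strict Implicit.
Unset Printing Implicit Defensive.

Local Open Scope group_scope.

(* Blocks form a set rather than a multiset. This loses nothing when
   lambda = 1 and k >= 2, where a repeated block would cover a pair twice. *)
Definition is_BIBD (V : finType) (v k lambda : nat) (A : {set {set V}}) :=
  [/\ #|V| = v,
      forall B : {set V}, B \in A -> #|B| = k
    & forall P : {set V}, #|P| = 2 ->
        #|[set B in A | P \subset B]| = lambda].

Definition is_resolution (V : finType) (A : {set {set V}})
    (R : {set {set {set V}}}) :=
  partition R A
  /\ (forall C : {set {set V}}, C \in R -> partition C [set: V]).

Definition is_RBIBD (V : finType) (v k lambda : nat) (A : {set {set V}})
    (R : {set {set {set V}}}) :=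
  is_BIBD v k lambda A /\ is_resolution A R.

(* 'P^* is the action induced on sets of points by the natural action 'P of
   permutations, and 'P^*^* the one induced on sets of sets of points. *)
Definition is_automorphism_group (V : finType) (A : {set {set V}})
    (R : {set {set {set V}}}) (H : {group {perm V}}) :=
  [acts H, on A | 'P^*] /\ [acts H, on R | 'P^*^*].

Definition sharply_transitive_on (V : finType) (H : {group {perm V}})
    (S : {set V}) :=
  [acts H, on S | 'P]
  /\ (forall x y : V, x \in S -> y \in S ->
        exists! h : {perm V}, h \in H /\ h x = y).

Definition one_rotational (V : finType) (A : {set {set V}})
    (R : {set {set {set V}}}) (gT : finGroupType) (G : {group gT}) :=
  exists (H : {group {perm V}}) (infty : V),
    [/\ H \isog G,
        is_automorphism_group A R H,
        forall h : {perm V}, h \in H -> h infty = infty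
      & sharply_transitive_on H [set~ infty]].

(* Main.v *)
Require Import Defs.
From HB Require Import structures.
From mathcomp Require Import all_boot all_fingroup all_algebra.

Set Implicit Arguments.
Unset Strict Implicit.
Unset Printing Implicit Defensive.

(** Take the points to be a group G of order 623 together with one further
point, None, fixed by G, and let N be the subgroup of order 7. Given 11 base
blocks of 8 elements of G, let the blocks be all right translates of these,
together with the sets made of None and a right coset of N.

If every element outside N is a difference b i s * (b i t)^-1 inside some base
block, then two points lie in a common block. As the 11 * 8 * 7 = 616
differences of distinct elements are just as many as the elements outside N,
each such element is a difference in exactly one way and no such difference
lies in N, so the block is unique ([blocks_BIBD]). If moreover every element
outside N is b i s * n for some n in N, the same count shows that the
translates of the base blocks by the elements of N tile the complement of N;
with the block made of None and N they form one parallel class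
([base_class_partition]). Its stabilizer is N and its translates under G form
the resolution ([resolution_partition]). The translations of G are then
automorphisms, fixing None and sharply transitive on G.

It remains to exhibit the base blocks in the integers modulo 623 = 7 * 89,
where N consists of the multiples of 89. They are the multiples of a single
block by the powers of 8, which is 1 modulo 7 and has order 11 modulo 89. Both
conditions are then finite computations ([residue_differences],
[residue_tiling]). *)

Local Open Scope group_scope.

(** * Finite sets, partitions and actions *)

(** A map from D onto at least as much as E, with #|D| = #|E|, is a bijection
from D to E. This turns coverage into uniqueness throughout. *)

Lemma cover_card_inj (aT rT : finType) (f : aT -> rT) (D : {set aT})
    (E : {set rT}) :
  E \subset f @: D -> #|D| = #|E| -> f @: D = E /\ {in D &, injective f}.
Proof.
move=> sEfD cDE; have/eqP fDE : E == f @: D.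
  by rewrite eqEcard sEfD -cDE leq_imset_card.
by split=> //; apply/imset_injP; rewrite -fDE cDE.
Qed.

Lemma partition_exists_unique (T : finType) (P : {set {set T}}) (D : {set T}) :
    set0 \notin P ->
    (forall X, X \in P -> X \subset D) ->
    (forall x, x \in D -> exists2 X, X \in P & x \in X) ->
    (forall X Y x, X \in P -> Y \in P -> x \in X -> x \in Y -> X = Y) ->
  partition P D.
Proof.
move=> P0 PD ex un; apply/and3P; split=> //.
  rewrite eqEsubset; apply/andP; split; first exact/bigcupsP.
  by apply/subsetP=> x /ex[X XP xX]; apply/bigcupP; exists X.
apply/trivIsetP=> X Y XP YP; apply: contraR => /pred0Pn[x /andP[xX xY]].
exact/eqP/(un X Y x).
Qed.

Lemma mem_setactE (aT : finGroupType) (T : finType) (to : {action aT &-> T})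
    (g : aT) (X : {set T}) x : (x \in to^* X g) = (to x g^-1 \in X).
Proof. by rewrite setactE (can2_imset_pre _ (actK to g) (actKV to g)) inE. Qed.

(** A permutation of the points sends partitions of the whole set of points to
partitions of it. *)
Lemma partition_setact (aT : finGroupType) (T : finType)
    (to : {action aT &-> T}) (P : {set {set T}}) (g : aT) :
  partition P [set: T] -> partition (to^*^* P g) [set: T].
Proof.
case/and3P=> /eqP covP /trivIsetP triv P0.
apply: partition_exists_unique => [|X _|x _|X Y x].
- by rewrite mem_setactE /= /setact imset0.
- exact: subsetT.
- have /bigcupP[X XP xX] : to x g^-1 \in cover P by rewrite covP.
  by exists (to^* X g); rewrite ?mem_setact // mem_setactE.
rewrite !mem_setactE => XP YP xX xY; apply: (act_inj to^* g^-1).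
apply/eqP; apply: contraT => /(triv _ _ XP YP)/pred0P/(_ (to x g^-1)).
by rewrite /= !mem_setact.
Qed.

(** * Right translations of a group with a fixed point added *)

(** The right translation by g on the elements of G, fixing the extra point
None. *)
Definition translate (G : finGroupType) (x : option G) (g : G) : option G :=
  omap (fun y => y * g) x.

Lemma translate_is_action (G : finGroupType) :
  is_action [set: G] (@translate G).
Proof.
apply: is_total_action => [[x|]|[x|] g h] //=.
  by rewrite /translate /= mulg1.
by rewrite /translate /= mulgA.
Qed.

(** Right translation as a total action of G on option G. *)
Canonical translation (G : finGroupType) := Action (@translate_is_action G).

Section Translations.

Variable G : finGroupType.

Notation to := (translation G).

(** The group of permutations of option G induced by right translations. *)
Definition translations : {group {perm option G}} :=
  (actperm to @* [set: G])%G.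

Lemma translationsP (h : {perm option G}) :
  reflect (exists g, h = actperm to g) (h \in translations).
Proof.
apply: (iffP morphimP) => [[g _ _ ->]|[g ->]]; first by exists g.
by exists g; rewrite ?inE.
Qed.

Lemma translations_isog : translations \isog [set: G].
Proof.
rewrite isog_sym; apply: sub_isog => //.
apply/injmP=> g h _ _ /permP/(_ (Some 1)).
by rewrite !actpermE /= /translate /= !mul1g => -[].
Qed.

Lemma translations_sharply_transitive :
  sharply_transitive_on translations [set~ None].
Proof.
split.
  apply/subsetP=> h hT; rewrite !inE /=; apply/subsetP=> x; rewrite !inE /=.
  by case/translationsP: hT => g ->; rewrite apermE actpermE; case: x.
move=> [x|] [y|]; rewrite !inE // => _ _.
exists (actperm to (x^-1 * y)); split.
  split; first by apply/translationsP; exists (x^-1 * y).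
  by rewrite actpermE /= /translate /= mulKVg.
move=> h [/translationsP[g ->]]; rewrite actpermE /= /translate /= => -[<-].
by rewrite mulKg.
Qed.

End Translations.

(** * The design of a resolvable relative difference family *)

Section DifferenceFamily.

(** The family b i, for i in I, of base blocks indexed by K is a resolvable
difference family in G relative to N. Only the existence of the
representations is assumed: their uniqueness follows from the count cardG. *)

Variables (G : finGroupType) (N : {group G}) (I K : finType).
Variable b : I -> K -> G.

Hypothesis cardK : #|K| = #|N|.+1.
Hypothesis cardG : #|G| = #|N| + #|I| * #|K| * #|N|.
Hypothesis differences : forall d : G, d \notin N ->
  exists i s t, d = b i s * (b i t)^-1.
Hypothesis tiling : forall x : G, x \notin N ->
  exists i s n, n \in N /\ x = b i s * n.

Notation to := (translation G).
Notation tr := (to^*)%act.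

Lemma card_compl : #|~: N| = (#|I| * #|K| * #|N|)%N.
Proof. by apply: (@addnI #|N|); rewrite cardsC cardG. Qed.

(** Outside N, each element is the difference of exactly one pair of distinct
elements of a base block, and these differences never lie in N. *)
Lemma differences_bij :
  let f (p : I * (K * K)) := b p.1 p.2.1 * (b p.1 p.2.2)^-1 in
  let D := [set p : I * (K * K) | p.2.1 != p.2.2] in
  f @: D = ~: N /\ {in D &, injective f}.
Proof.
move=> f D.
have cD : #|D| = #|~: N|.
  (* The complement of D, the diagonal, has #|I| * #|K| elements. *)
  pose E : {set I * (K * K)} := setX [set: I] [set p | p.1 == p.2].
  have -> : D = ~: E by apply/setP=> -[j [u v]]; rewrite !inE.
  apply: (@addnI #|E|); rewrite cardsC card_compl /E cardsX cardsT !card_prod.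
  have -> : #|[set p : K * K | p.1 == p.2]| = #|K|.
    rewrite -[RHS](@card_imset _ _ (fun u : K => (u, u))).
      apply: eq_card => -[u v]; rewrite inE /=.
      apply/eqP/imsetP => [->|[w _ [-> ->]]] //; by exists v.
    by move=> u v [].
  by rewrite -mulnA -mulnDr -mulnS -cardK.
apply: cover_card_inj cD.
apply/subsetP=> d dN; rewrite inE in dN.
have [j [u [v e]]] := differences dN.
apply/imsetP; exists (j, (u, v)) => //; rewrite inE /=.
by apply: contraNneq dN => uv; rewrite e uv mulgV group1.
Qed.

Lemma difference_unique i s t i' s' t' : s != t -> s' != t' ->
  b i s * (b i t)^-1 = b i' s' * (b i' t')^-1 ->
  [/\ i = i', s = s' & t = t'].
Proof.
move=> st st' e; have [_ inj] := differences_bij.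
have := inj (i, (s, t)) (i', (s', t')).
by rewrite !inE => /(_ st st' e) [-> -> ->].
Qed.

Lemma difference_notin i s t : s != t -> b i s * (b i t)^-1 \notin N.
Proof.
move=> st; have [im _] := differences_bij.
rewrite -in_setC -im; apply/imsetP; exists (i, (s, t)) => //.
by rewrite inE.
Qed.

(** The translates of the base blocks by elements of N tile the complement of
N. *)
Lemma tiling_bij :
  let f (p : I * K * G) := b p.1.1 p.1.2 * p.2 in
  let D := setX [set: I * K] N in
  f @: D = ~: N /\ {in D &, injective f}.
Proof.
move=> f D; apply: cover_card_inj.
  apply/subsetP=> x; rewrite inE => /tiling[i [s [n [nN ->]]]].
  by apply/imsetP; exists (i, s, n) => //; rewrite !inE.
by rewrite cardsX cardsT card_prod card_compl.
Qed.

Lemma tiling_unique i s n i' s' n' : n \in N -> n' \in N ->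
  b i s * n = b i' s' * n' -> [/\ i = i', s = s' & n = n'].
Proof.
move=> nN nN' e; have [_ inj] := tiling_bij.
have := inj (i, s, n) (i', s', n').
by rewrite !inE /= => /(_ nN nN' e) [-> -> ->].
Qed.

Lemma tiling_notin i s n : n \in N -> b i s * n \notin N.
Proof.
move=> nN; have [im _] := tiling_bij.
by rewrite -in_setC -im; apply/imsetP; exists (i, s, n); rewrite ?inE.
Qed.

(** The right translate by g of the i-th base block. *)
Definition base_translate (i : I) (g : G) : {set option G} :=
  [set Some (b i s * g) | s : K].

(** The block through the fixed point None and the right coset N g. *)
Definition infinite_block (g : G) : {set option G} :=
  None |: Some @: (N :* g).

(** The parallel class that contains None with N. *)
Definition base_class : {set {set option G}} :=
  infinite_block 1 |: [set base_translate i n | i in I, n in N].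

(** The parallel classes are the translates of the base one. *)
Definition resolution : {set {set {set option G}}} :=
  orbit (to^*^*) [set: G] base_class.

(** The blocks are the members of the parallel classes; [blocksP] describes
them directly. *)
Definition blocks : {set {set option G}} := cover resolution.

Lemma mem_base_translate i g x :
  reflect (exists s, x = Some (b i s * g)) (x \in base_translate i g).
Proof. by apply: (iffP imsetP) => [[s _ ->]|[s ->]]; exists s. Qed.

Lemma mem_infinite_block g x :
  (x \in infinite_block g) = if x is Some y then y * g^-1 \in N else true.
Proof.
rewrite !inE; case: x => [y|] //=.
by rewrite mem_imset ?mem_rcoset // => u v [].
Qed.

Lemma translate_base_translate i g h :
  tr (base_translate i g) h = base_translate i (g * h).
Proof.
rewrite /= setactE -imset_comp; apply: eq_imset => s /=.
by rewrite /translate /= mulgA.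
Qed.

Lemma translate_infinite_block g h :
  tr (infinite_block g) h = infinite_block (g * h).
Proof.
apply/setP=> x; rewrite (mem_setactE to) !mem_infinite_block.
by case: x => [x|] //=; rewrite invMg mulgA.
Qed.

Lemma infinite_block_eq g h : g * h^-1 \in N ->
  infinite_block g = infinite_block h.
Proof.
rewrite -mem_rcoset => /rcoset_eqP e.
by rewrite /infinite_block e.
Qed.

Lemma base_classP X :
  reflect (X = infinite_block 1 \/
           exists i n, n \in N /\ X = base_translate i n)
          (X \in base_class).
Proof.
rewrite !inE; apply: (iffP orP) => [[/eqP->|/imset2P[i n _ nN ->]]|].
- by left.
- by right; exists i, n.
case=> [->|[i [n [nN ->]]]]; first by left.
by right; apply/imset2P; exists i n.
Qed.

Lemma blocksP X :
  reflect ((exists g, X = infinite_block g) \/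
           exists i g, X = base_translate i g)
          (X \in blocks).
Proof.
apply: (iffP bigcupP) => [[C /orbitP[g _ <-] /imsetP[Y YB ->]]|].
  case/base_classP: YB => [->|[i [n [_ ->]]]].
    by left; exists (1 * g); rewrite translate_infinite_block.
  by right; exists i, (n * g); rewrite translate_base_translate.
case=> [[g ->]|[i [g ->]]]; exists ((to^*^*)%act base_class g);
  rewrite ?mem_orbit ?inE //.
  by rewrite -[g]mul1g -translate_infinite_block mul1g mem_setact ?setU11.
rewrite -[g]mul1g -translate_base_translate mul1g mem_setact //.
by apply/base_classP; right; exists i, 1.
Qed.

Lemma card_blocks X : X \in blocks -> #|X| = #|K|.
Proof.
case/blocksP=> [[g ->]|[i [g ->]]].
  rewrite cardsU1 card_imset; last by move=> u v [].
  by rewrite card_rcoset cardK; case: imsetP => // -[].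
rewrite card_imset // => s t [/mulIg e]; apply: contraTeq isT => st.
by have := difference_notin i st; rewrite e mulgV group1.
Qed.

(** Two distinct points x and y of a translate of a base block are Some u and
Some v; the quotient u * v^-1 determines the base block and their positions in
it, and then u determines the translation. *)
Lemma base_translate_two_points i g i' g' x y : x != y ->
    x \in base_translate i g -> y \in base_translate i g ->
    x \in base_translate i' g' -> y \in base_translate i' g' ->
  i = i' /\ g = g'.
Proof.
move=> xy /mem_base_translate[s xs] /mem_base_translate[t yt].
case/mem_base_translate=> s' xs' /mem_base_translate[t' yt'].
have st : s != t by apply: contraNneq xy => st; rewrite xs yt st.
have st' : s' != t' by apply: contraNneq xy => st'; rewrite xs' yt' st'.
move: xs' yt'; rewrite xs yt => -[ex] [ey].
have [|ei es et] := @difference_unique i s t i' s' t' st st'.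
  have d z z' h : z * z'^-1 = (z * h) * (z' * h)^-1 :> G.
    by rewrite invMg mulgA mulgK.
  by rewrite (d _ _ g) ex ey -d.
by subst; split=> //; apply: (mulgI (b i' s')).
Qed.

Lemma blocks_unique x y X Y : x != y -> X \in blocks -> Y \in blocks ->
  x \in X -> y \in X -> x \in Y -> y \in Y -> X = Y.
Proof.
(* The quotient of two distinct points is outside N in a base translate, and
   inside N in an infinite block. *)
have sep i g h : x != y -> x \in base_translate i g ->
    y \in base_translate i g -> x \in infinite_block h ->
    y \in infinite_block h -> False.
  move=> xy /mem_base_translate[s xs] /mem_base_translate[t yt].
  have st : s != t by apply: contraNneq xy => st; rewrite xs yt st.
  rewrite xs yt !mem_infinite_block => sN tN.
  have /negP[] := difference_notin i st.
  have := groupM sN (groupVr tN).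
  by rewrite !invMg !invgK !mulgA !mulgKV mulgK.
move=> xy /blocksP[[g ->]|[i [g ->]]] /blocksP[[g' ->]|[i' [g' ->]]].
all: move=> xX yX xY yY.
- have infb z : z \in infinite_block g -> z \in infinite_block g' ->
      z != None -> infinite_block g = infinite_block g'.
    case: z => [z|] //; rewrite !mem_infinite_block => zg zg' _.
    apply: infinite_block_eq; have := groupM (groupVr zg) zg'.
    by rewrite invMg invgK mulgA mulgKV.
  have [ex|] := eqVneq x None; last exact: infb xX xY.
  by apply: infb yX yY _; rewrite -ex eq_sym.
- by case: (sep _ _ _ xy xY yY xX yX).
- by case: (sep _ _ _ xy xX yX xY yY).
by have [-> ->] := base_translate_two_points xy xX yX xY yY.
Qed.

Lemma blocks_exist x y :
  x != y -> exists X, [/\ X \in blocks, x \in X & y \in X].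
Proof.
move=> xy; have infb g : infinite_block g \in blocks.
  by apply/blocksP; left; exists g.
case: x y xy => [x|] [y|] // xy; last 2 first.
- by exists (infinite_block x); rewrite infb !mem_infinite_block ?mulgV ?group1.
- by exists (infinite_block y); rewrite infb !mem_infinite_block ?mulgV ?group1.
have [xyN|/differences[i [s [t e]]]] := boolP (x * y^-1 \in N).
  by exists (infinite_block y); rewrite infb !mem_infinite_block ?mulgV ?group1.
(* The translate that sends b i t to y sends b i s to x. *)
exists (base_translate i ((b i t)^-1 * y)); split.
- by apply/blocksP; right; exists i, ((b i t)^-1 * y).
- by apply/mem_base_translate; exists s; rewrite mulgA -e mulgKV.
by apply/mem_base_translate; exists t; rewrite mulKVg.
Qed.

Lemma blocks_BIBD : is_BIBD #|G|.+1 #|K| 1 blocks.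
Proof.
split; [exact: card_option | exact: card_blocks | move=> P /eqP/cards2P].
case=> x [y [xy ->]]; have [X [XA xX yX]] := blocks_exist xy.
apply/eqP/cards1P; exists X; apply/setP=> Y; rewrite !inE subUset !sub1set.
apply/and3P/eqP => [[YA xY yY]|->]; last by [].
exact: (blocks_unique xy).
Qed.

Lemma base_class_partition : partition base_class [set: option G].
Proof.
apply: partition_exists_unique => [|X _|x _|X Y x].
- apply/negP=> /base_classP[/setP/(_ None)|[i [n [_ /setP e]]]].
    by rewrite mem_infinite_block inE.
  have /card_gt0P[s _] : 0 < #|K| by rewrite cardK.
  have := e (Some (b i s * n)); rewrite inE => /esym/negP[].
  by apply/mem_base_translate; exists s.
- exact: subsetT.
- case: x => [x|]; last first.
    by exists (infinite_block 1); rewrite ?setU11 ?mem_infinite_block.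
  have [xN|/tiling[i [s [n [nN ->]]]]] := boolP (x \in N).
    exists (infinite_block 1); first exact: setU11.
    by rewrite mem_infinite_block invg1 mulg1.
  exists (base_translate i n); first by apply/base_classP; right; exists i, n.
  by apply/mem_base_translate; exists s.
have sep i n : n \in N -> x \in base_translate i n ->
    x \in infinite_block 1 -> False.
  move=> nN /mem_base_translate[s ->].
  by rewrite mem_infinite_block invg1 mulg1; apply/negP/tiling_notin.
case/base_classP=> [->|[i [n [nN ->]]]];
  case/base_classP=> [->|[i' [n' [nN' ->]]]] // xX xY.
- by case: (sep _ _ nN' xY xX).
- by case: (sep _ _ nN xX xY).
case/mem_base_translate: xX => s xs; case/mem_base_translate: xY => s' xs'.
move: xs'; rewrite xs => -[e].
by have [-> _ ->] := tiling_unique nN nN' e.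
Qed.

Lemma base_translate_inj i g i' g' :
  base_translate i g = base_translate i' g' -> i = i' /\ g = g'.
Proof.
(* A block has at least two points, as #|K| = #|N| + 1. *)
move=> e; have : 1 < #|base_translate i g|.
  rewrite card_blocks ?cardK ?ltnS ?cardG_gt0 //.
  by apply/blocksP; right; exists i, g.
case/card_gt1P=> x [y [xX yX xy]].
by apply: (base_translate_two_points xy); rewrite -?e.
Qed.

Lemma base_class_stable n : n \in N -> (to^*^*)%act base_class n = base_class.
Proof.
move=> nN; apply/eqP; rewrite eqEcard card_setact leqnn andbT.
apply/subsetP=> _ /imsetP[X /base_classP XB ->]; apply/base_classP.
case: XB => [->|[i [m [mN ->]]]]; [left | right].
  rewrite translate_infinite_block; apply: infinite_block_eq.
  by rewrite mul1g invg1 mulg1.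
by exists i, (m * n); rewrite translate_base_translate groupM.
Qed.

Lemma resolution_partition : partition resolution blocks.
Proof.
apply: partition_exists_unique => [|C|X /bigcupP[C] //|C C' X].
- apply/negP=> /orbitP[g _ /setP/(_ (tr (infinite_block 1) g))].
  by rewrite inE mem_setact ?setU11.
- exact: bigcup_sup.
- by exists C.
case/orbitP=> g _ <-; case/orbitP=> h _ <- Xg Xh.
(* If the translates of the base class by g and h share the block X, then g and
   h are in the same coset of N, so that the two translates are equal. *)
have ghN : g * h^-1 \in N.
  have none i u v : base_translate i u = infinite_block v -> False.
    move/setP/(_ None); rewrite mem_infinite_block.
    by case/mem_base_translate.
  case/imsetP: Xg => Y /base_classP YB XY.
  case/imsetP: Xh => Z /base_classP ZB.
  rewrite {}XY; case: YB ZB => [->|[i [n [nN ->]]]] [->|[j [m [mN ->]]]];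
    rewrite ?translate_base_translate ?translate_infinite_block.
  - move/setP/(_ (Some g)); rewrite !mem_infinite_block !mul1g mulgV group1.
    by move=> <-.
  - by move/esym/none.
  - by move/none.
  case/base_translate_inj=> _ e; have := groupM (groupVr nN) mN.
  by rewrite -(mulgK h m) -e !mulgA mulVg mul1g.
by rewrite -[g](mulgKV h) actMin ?inE // base_class_stable.
Qed.

Lemma blocks_RBIBD : is_RBIBD #|G|.+1 #|K| 1 blocks resolution.
Proof.
split; first exact: blocks_BIBD.
split; first exact: resolution_partition.
by move=> C /orbitP[g _ <-]; apply/partition_setact/base_class_partition.
Qed.

Lemma blocks_automorphisms :
  is_automorphism_group blocks resolution (translations G).
Proof.
have trP g (X : {set option G}) : ('P^*)%act X (actperm to g) = tr X g.
  by apply: eq_imset => x; rewrite /= apermE actpermE.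
have trPP g (C : {set {set option G}}) :
    ('P^*^*)%act C (actperm to g) = (to^*^*)%act C g.
  by apply: eq_imset => X; apply: trP.
have resP g C : C \in resolution -> (to^*^*)%act C g \in resolution.
  by case/orbitP=> h _ <-; rewrite -actMin ?inE // mem_orbit ?inE.
split; apply/subsetP=> h /translationsP[g ->]; rewrite !inE; apply/subsetP.
  move=> X /bigcupP[C CR XC]; rewrite inE trP.
  apply/bigcupP; exists ((to^*^*)%act C g); first exact: resP.
  exact: mem_setact.
by move=> C CR; rewrite inE trPP; apply: resP.
Qed.

Lemma blocks_one_rotational : one_rotational blocks resolution [set: G]%G.
Proof.
exists (translations G), None; split.
- exact: translations_isog.
- exact: blocks_automorphisms.
- by move=> h /translationsP[g ->]; rewrite actpermE.
exact: translations_sharply_transitive.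
Qed.

End DifferenceFamily.

(** * A difference family modulo 623 *)

(** The s-th element of the i-th base block, as a natural number below 623: the
first block multiplied by 8 ^ i. Modulo 7 the first block takes each of the
values 0, 3, 5 and 6 twice, and modulo 89 its elements represent the 8 cosets
of the multiplicative subgroup of order 11 generated by 8. *)
Definition residue (i s : nat) : nat :=
  iter i (fun c => 8 * c %% 623)%N
    (nth 0%N [:: 357; 49; 241; 528; 117; 551; 615; 230]%N s).

Lemma residue_lt i s : residue i s < 623.
Proof.
by case: i => [|i]; [do 8!case: s => [|s] //; case: s | rewrite /= ltn_mod].
Qed.

(** The 616 differences inside the base blocks are the residues modulo 623 that
are not multiples of 89, each obtained once. *)
Lemma residue_differences :
  sort leq [seq (residue p.1 p.2.1 + (623 - residue p.1 p.2.2)) %% 623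
             | p <- [seq (i, st) | i <- iota 0 11,
                                   st <- [seq (s, t) | s <- iota 0 8,
                                                       t <- iota 0 8]]
             & p.2.1 != p.2.2]%N
  = [seq d <- iota 0 623 | ~~ (89 %| d)].
Proof. by vm_compute. Qed.

(** The elements of the base blocks represent the nonzero residues modulo 89,
each once. *)
Lemma residue_tiling :
  sort leq [seq residue i s %% 89 | i <- iota 0 11, s <- iota 0 8]
  = iota 1 88.
Proof. by vm_compute. Qed.

Lemma multiples_of_89_group_set : group_set [set x : 'Z_623 | 89 %| x].
Proof.
apply/group_setP; split=> [|x y]; first by rewrite inE dvdn0.
rewrite !inE => xN yN.
by rewrite [X in 89 %| X]/= /dvdn modn_dvdm // [_ == _]dvdn_add.
Qed.

(** The subgroup of order 7 of the integers modulo 623. *)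
Definition multiples_of_89 : {group 'Z_623} := group multiples_of_89_group_set.

Lemma card_multiples_of_89 : #|multiples_of_89| = 7.
Proof.
rewrite cardsE -sum1_card.
rewrite -(big_mkord (fun i => 89 %| i) (fun=> 1%N)).
by rewrite unlock; vm_compute.
Qed.

(** The base blocks in the integers modulo 623. *)
Definition base (i : 'I_11) (s : 'I_8) : 'Z_623 := inZp (residue i s).

(** In the group 'Z_623 the multiplicative notation stands for addition, so
that x * y^-1 is the difference of x and y. *)
Lemma base_differences (d : 'Z_623) : d \notin multiples_of_89 ->
  exists i s t, d = base i s * (base i t)^-1.
Proof.
rewrite inE => dN.
have : val d \in [seq d <- iota 0 623 | ~~ (89 %| d)].
  by rewrite mem_filter dN mem_iota; apply: ltn_ord.
rewrite -residue_differences mem_sort => /mapP[[i [s t]]].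
rewrite mem_filter => /andP[_ /allpairsPdep[i' [st' [iI stI [-> e]]]]] /= dE.
move: stI e => /allpairsPdep[s' [t' [sI tI ->]]] [es et].
rewrite {}es {}et in dE.
rewrite !mem_iota /= in iI sI tI.
exists (Ordinal iI), (Ordinal sI), (Ordinal tI).
by apply: ord_inj; rewrite dE /= !(modn_small (residue_lt _ _)) modnDmr.
Qed.

Lemma base_tiling (x : 'Z_623) : x \notin multiples_of_89 ->
  exists i s n, n \in multiples_of_89 /\ x = base i s * n.
Proof.
rewrite inE => xN.
have : x %% 89 \in iota 1 88.
  by rewrite mem_iota lt0n xN ltn_mod.
rewrite -residue_tiling mem_sort => /allpairsPdep[i [s [iI sI e]]].
rewrite !mem_iota /= in iI sI.
exists (Ordinal iI), (Ordinal sI), ((base (Ordinal iI) (Ordinal sI))^-1 * x).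
split; last by rewrite mulKVg.
have r_lt := residue_lt i s.
rewrite inE /= modnDml (modn_small r_lt) /dvdn modn_dvdm // -/(dvdn _ _).
rewrite addnC addnBA 1?ltnW // -eqn_mod_dvd; last by rewrite ltnW ?ltn_addl.
by rewrite -modnDmr addn0 e.
Qed.

Local Close Scope group_scope.

(* 'Z_623 is regarded as a group under addition. *)
Theorem theorem2p3 :
  exists (V : finType) (A : {set {set V}}) (R : {set {set {set V}}}),
    is_RBIBD 624 8 1 A R /\ one_rotational A R [set: 'Z_623]%G.
Proof.
have cardK : #|'I_8| = #|multiples_of_89|.+1.
  by rewrite card_ord card_multiples_of_89.
have cardG : #|'Z_623| =
    #|multiples_of_89| + #|'I_11| * #|'I_8| * #|multiples_of_89|.
  by rewrite !card_ord card_multiples_of_89.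
exists (option 'Z_623), (blocks multiples_of_89 base),
  (resolution multiples_of_89 base); split.
  have := blocks_RBIBD cardK cardG base_differences base_tiling.
  by rewrite !card_ord.
exact: (blocks_one_rotational multiples_of_89 base).
Qed.
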